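(* Let $D \subset \mathbb{R}^2$ be a bounded domain with smooth (of class $C^2$) boundary $\partial D$. For each $\mu > 0$ let $v(\cdot,\mu)$ denote the unique real-valued solution of the Dirichlet problem $$\nabla^2 v - \mu^2 v = 0 \ \text{ in } D, \qquad v = 1 \ \text{ on } \partial D .$$ Suppose that there exists $\mu_0 > 0$ such that for all $\mu > \mu_0$ $$|\nabla v(x,\mu)| \leq \mu\, v(x,\mu) \quad \text{for all } x \in D .$$ Then $D$ is convex.
   Context: A domain is a nonempty connected open set. Here $x=(x_1,x_2)$, $\nabla = (\partial_1,\partial_2)$ with $\partial_i = \partial/\partial x_i$ is the gradient in the variable $x$, $\nabla^2 = \partial_1^2+\partial_2^2$ is the Laplacian, and $|\cdot|$ is the Euclidean norm in $\mathbb{R}^2$. The solution $v(\cdot,\mu)$ is understood in the classical sense: $v(\cdot,\mu) \in C^2(D)\cap C(\overline{D})$ satisfies the equation pointwise in $D$ and the boundary condition pointwise on $\partial D$. For a bounded domain with $C^2$ boundary such a solution exists and is unique for every $\mu>0$. *)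

(* Defs.v *)
From HB Require Import structures.
From mathcomp Require Import all_boot all_order all_algebra.
From mathcomp Require Import all_classical all_reals all_analysis.

Set Implicit Arguments.
Unset Strict Implicit.
Unset Printing Implicit Defensive.

Import Order.TTheory GRing.Theory Num.Theory.
Import numFieldNormedType.Exports.

Local Open Scope classical_set_scope.
Local Open Scope ring_scope.

Section Defs.
Context {R : realType}.

Section Dim.
Context {n : nat}.
Implicit Types (A D : set 'rV[R]_n) (f : 'rV[R]_n -> R) (x : 'rV[R]_n).

Definition domain D := [/\ D !=set0, open D & connected D].

Definition boundary D : set 'rV[R]_n := closure D `\` interior D.

(* The norm `|x| of 'rV[R]_n is the sup norm: it defines the topology and the
   bounded sets, whereas the gradient is measured in the Euclidean norm. *)
Definition enorm x : R := Num.sqrt (\sum_(i < n) x 0 i ^+ 2).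

Definition partial (i : 'I_n) f : 'rV[R]_n -> R := 'D_(delta_mx 0 i) f.

Definition grad f x : 'rV[R]_n := \row_(i < n) partial i f x.

Definition laplacian f x : R := \sum_(i < n) partial i (partial i f) x.

(* For A open. The operator 'D_v is total, so the existence of the partial
   derivatives has to be required separately. *)
Definition C1_on A f :=
  {in A, continuous f} /\
  forall i : 'I_n, (forall x, A x -> derivable f x (delta_mx 0 i)) /\
                   {in A, continuous (partial i f)}.

Definition C2_on A f := C1_on A f /\ forall i : 'I_n, C1_on A (partial i f).

(* Classical solution of the Dirichlet problem; only the values of f on the
   closure of D matter. *)
Definition dirichlet_solution D (mu : R) f :=
  [/\ C2_on D f,
      {within closure D, continuous f},
      forall x, D x -> laplacian f x - mu ^+ 2 * f x = 0
    & forall x, boundary D x -> f x = 1].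

End Dim.

Definition C2_fun (g : R -> R) :=
  [/\ forall t, derivable g t 1,
      forall t, derivable (derive1 g) t 1
    & continuous (derive1 (derive1 g))].

(* Near each boundary point, in suitable orthonormal coordinates y *m Q,
   D is the set of points lying strictly above the graph of a C^2 function. *)
Definition C2_boundary (D : set 'rV[R]_2) :=
  forall p, boundary D p ->
    exists (Q : 'M[R]_2) (g : R -> R),
      [/\ Q *m Q^T = 1%:M, C2_fun g
        & \forall y \near p, D y <-> g ((y *m Q) 0 0) < (y *m Q) 0 1].

End Defs.

(* Main.v *)
Require Import Defs.
From HB Require Import structures.
From mathcomp Require Import all_boot all_order all_algebra.
From mathcomp Require Import all_classical all_reals all_analysis.
From mathcomp Require Import ring lra.

Import Order.TTheory GRing.Theory Num.Theory.
Import numFieldNormedType.Exports.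
Local Open Scope classical_set_scope.
Local Open Scope ring_scope.

(** Put w = - ln v / mu.  The equation for v reads
    laplacian w = mu (|grad w|^2 - 1), so the gradient bound |grad v| <= mu v
    says exactly that w is superharmonic.  As mu grows, w tends to the
    distance from the boundary of D, and that distance would therefore be
    superharmonic.  This fails if D is not convex: such a D has a boundary
    point p near which D contains everything outside some disc with centre c
    and p on its circle, so just beyond p, on the ray from c, the distance to
    the boundary is touched from below by |x - c| - |p - c|, whose laplacian
    1 / |x - c| is positive.

    The proof carries this out at a single large mu, without logarithms and
    without a limit.  Let q be beyond p on the ray from c, and let
    phi(x) = |x - c| - eta |x - q|^2, with eta so small that phi is still
    strictly subharmonic.  On a small disc around q consider
    F = v exp(mu phi).  Two estimates confine the maximum of F to the open
    disc:
    - [decay_along_segment]: integrating the gradient bound from p to q gives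
      v(q) >= exp(- mu |q - p|);
    - [ball_decay]: comparison with a radial barrier gives
      v(x) <= exp(- mu (1 - o(1)) r) when the ball of radius r around x lies
      in D; together with the term eta |x - q|^2 this makes F smaller on the
      circle around q than at q.
    At an interior maximum of F the first and second order conditions
    [barrier_touching] combine with the equation and the gradient bound into
    laplacian phi <= 0, a contradiction; this is
    [no_contact_from_outside_disc].

    The point p comes from [contact_from_outside_disc].  If D is connected but
    not convex, some segment [x, y] leaves D although [x, y'] stays in D for
    points y' as near to y as we like.  The part of the complement of D near
    [x, y] is then compact and bounded on one side by [x, y'], and its point
    farthest from a centre far away on the other side can serve as p. *)

Set Implicit Arguments.
Unset Strict Implicit.
Unset Printing Implicit Defensive.

(** * Euclidean geometry of row vectors *)

Definition sqnorm {R : realType} {n} (x : 'rV[R]_n) : R := \sum_i x 0 i ^+ 2.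

Lemma sqnorm_ge0 {R : realType} n (x : 'rV[R]_n) : 0 <= sqnorm x.
Proof. by apply: sumr_ge0 => i _; exact: sqr_ge0. Qed.

(** Along a coordinate axis the squared norm is a quadratic polynomial, which
    reduces every derivative of a barrier to one variable. *)
Lemma sqnorm_line {R : realType} n (x : 'rV[R]_n) (i : 'I_n) t :
  sqnorm (x + t *: delta_mx 0 i) = sqnorm x + 2 * t * x 0 i + t ^+ 2.
Proof.
rewrite /sqnorm (bigD1 i)//= [in RHS](bigD1 i)//= !mxE !eqxx mulr1.
rewrite (eq_bigr (fun j => x 0 j ^+ 2)); last first.
  by move=> j ji; rewrite !mxE (negbTE ji) mulr0 addr0.
by ring.
Qed.

Lemma sqnorm2 {R : realType} (z : 'rV[R]_2) :
  sqnorm z = z 0 0 ^+ 2 + z 0 1 ^+ 2.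
Proof.
rewrite /sqnorm big_ord_recl big_ord1; congr (_ + z 0 _ ^+ 2).
exact/val_inj.
Qed.

Lemma row2P {R : realType} (z w : 'rV[R]_2) :
  z 0 0 = w 0 0 -> z 0 1 = w 0 1 -> z = w.
Proof.
move=> E0 E1; apply/rowP => i.
case: (unliftP 0 i) => [j ->|-> //]; rewrite ord1.
by have -> : lift 0 0 = 1 :> 'I_2 by exact/val_inj.
Qed.

Lemma enorm_ge0 {R : realType} n (x : 'rV[R]_n) : 0 <= enorm x.
Proof. exact: sqrtr_ge0. Qed.

Lemma enorm_sqr {R : realType} n (x : 'rV[R]_n) : enorm x ^+ 2 = sqnorm x.
Proof. by rewrite sqr_sqrtr// sqnorm_ge0. Qed.

Lemma enorm0 {R : realType} n : enorm (0 : 'rV[R]_n) = 0.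
Proof.
by rewrite /enorm big1 ?sqrtr0// => i _; rewrite mxE expr0n.
Qed.

Lemma enormN {R : realType} n (x : 'rV[R]_n) : enorm (- x) = enorm x.
Proof. by congr Num.sqrt; apply: eq_bigr => i _; rewrite mxE sqrrN. Qed.

Lemma enormZ {R : realType} n (k : R) (x : 'rV[R]_n) :
  enorm (k *: x) = `|k| * enorm x.
Proof.
rewrite -sqrtr_sqr -sqrtrM ?sqr_ge0//; congr Num.sqrt.
by rewrite mulr_sumr; apply: eq_bigr => i _; rewrite mxE exprMn.
Qed.

Lemma coord_le_enorm {R : realType} n (x : 'rV[R]_n) i : `|x 0 i| <= enorm x.
Proof.
rewrite -sqrtr_sqr ler_wsqrtr// (bigD1 i)//= lerDl.
by apply: sumr_ge0 => j _; exact: sqr_ge0.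
Qed.

Lemma enorm_eq0 {R : realType} n (z : 'rV[R]_n) : enorm z = 0 -> z = 0.
Proof.
move=> z0; apply/rowP => i; have := coord_le_enorm z i.
by rewrite z0 normr_le0 mxE => /eqP.
Qed.

Lemma cauchy_schwarz_enorm {R : realType} n (x y : 'rV[R]_n) :
  \sum_i x 0 i * y 0 i <= enorm x * enorm y.
Proof.
have [x0|x0] := eqVneq (enorm x) 0.
  rewrite x0 mul0r big1// => i _; have := coord_le_enorm x i.
  by rewrite x0 normr_le0 => /eqP ->; rewrite mul0r.
have [y0|y0] := eqVneq (enorm y) 0.
  rewrite y0 mulr0 big1// => i _; have := coord_le_enorm y i.
  by rewrite y0 normr_le0 => /eqP ->; rewrite mulr0.
have {}x0 : 0 < enorm x by rewrite lt_neqAle eq_sym x0 enorm_ge0.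
have {}y0 : 0 < enorm y by rewrite lt_neqAle eq_sym y0 enorm_ge0.
have xy0 : 0 < 2 * (enorm x * enorm y) by rewrite mulr_gt0// mulr_gt0.
rewrite -(ler_pM2l xy0) mulr_sumr.
apply: (@le_trans _ _ (\sum_i (enorm y ^+ 2 * x 0 i ^+ 2 +
                                enorm x ^+ 2 * y 0 i ^+ 2))).
  apply: ler_sum => i _; rewrite -subr_ge0.
  have -> : enorm y ^+ 2 * x 0 i ^+ 2 + enorm x ^+ 2 * y 0 i ^+ 2 -
     2 * (enorm x * enorm y) * (x 0 i * y 0 i) =
     (enorm y * x 0 i - enorm x * y 0 i) ^+ 2 by ring.
  exact: sqr_ge0.
rewrite big_split/= -!mulr_sumr -!/(sqnorm _) -!enorm_sqr.
by rewrite le_eqVlt; apply/orP; left; apply/eqP; ring.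
Qed.

Lemma enormD {R : realType} n (x y : 'rV[R]_n) :
  enorm (x + y) <= enorm x + enorm y.
Proof.
rewrite -(@ler_pXn2r _ 2)// ?nnegrE ?addr_ge0 ?enorm_ge0//.
have -> : enorm (x + y) ^+ 2 =
    enorm x ^+ 2 + enorm y ^+ 2 + 2 * \sum_i x 0 i * y 0 i.
  rewrite !enorm_sqr /sqnorm mulr_sumr -!big_split/=.
  by apply: eq_bigr => i _; rewrite mxE; ring.
have -> : (enorm x + enorm y) ^+ 2 =
    enorm x ^+ 2 + enorm y ^+ 2 + 2 * (enorm x * enorm y) by ring.
by rewrite lerD2l ler_pM2l// cauchy_schwarz_enorm.
Qed.

Lemma enormBC {R : realType} n (x y : 'rV[R]_n) : enorm (x - y) = enorm (y - x).
Proof. by rewrite -enormN opprB. Qed.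

Lemma enormB_tri {R : realType} n (x y z : 'rV[R]_n) :
  enorm (x - z) <= enorm (x - y) + enorm (y - z).
Proof. by rewrite (le_trans _ (enormD _ _))// addrA subrK. Qed.

Lemma sqnorm_continuous {R : realType} n : continuous (@sqnorm R n).
Proof.
apply: continuous_big => [|i _ x]; first exact: add_continuous.
apply: (@continuous_comp _ _ _ (fun x : 'rV[R]_n => x 0 i) (@GRing.exp R ^~ 2)).
  exact: coord_continuous.
exact: exprn_continuous.
Qed.

Lemma enorm_continuous {R : realType} n : continuous (@enorm R n).
Proof.
move=> x; apply: (@continuous_comp _ _ _ (@sqnorm R n) Num.sqrt).
  exact: sqnorm_continuous.
exact: sqrt_continuous.
Qed.

Lemma enormB_continuous {R : realType} n (c : 'rV[R]_n) :
  continuous (fun x : 'rV[R]_n => enorm (x - c)).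
Proof.
move=> x; apply: (@continuous_comp _ _ _ (fun x : 'rV[R]_n => x - c) (@enorm R n)).
  by apply: continuousB; [exact: cvg_id|exact: cst_continuous].
exact: enorm_continuous.
Qed.

(** The topology of row vectors comes from the sup norm; this lets
    neighbourhoods be handled through Euclidean balls. *)
Lemma near_enorm {R : realType} n (x : 'rV[R]_n) (P : 'rV[R]_n -> Prop) :
  (\forall y \near x, P y) <->
  (exists2 d, 0 < d & forall y, enorm (y - x) < d -> P y).
Proof.
split=> [/nbhs_ballP[d /= d0 H]|[d d0 H]].
  exists d => // y yx; apply: H; rewrite -ball_normE /= distrC.
  rewrite [ltLHS]/Num.norm/= mx_normrE; apply/bigmax_ltP; split=> // -[i j] _ /=.
  by rewrite !ord1 (le_lt_trans (coord_le_enorm _ _)).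
have C := @enormB_continuous _ _ x x.
have d0' : enorm (x - x) < d by rewrite subrr enorm0.
by apply: filterS (cvgr_lt (enorm (x - x)) C d d0') => y; exact: H.
Qed.

Lemma compact_enorm_ball {R : realType} n (x0 : 'rV[R]_n) (r : R) :
  compact [set y | enorm (y - x0) <= r].
Proof.
apply: bounded_closed_compact.
  exists (`|x0| + r); split => //; first exact: num_real.
  move=> M rM y /= yr; rewrite (le_trans _ (ltW rM))//.
  rewrite -[y](subrK x0) addrC (le_trans (ler_normD _ _))// lerD2l.
  rewrite [leLHS]/Num.norm/= mx_normrE; apply/bigmax_leP; split=> //=.
    exact: le_trans (enorm_ge0 _) yr.
  by move=> -[i j] _ /=; rewrite !ord1 (le_trans (coord_le_enorm _ _)).
rewrite (_ : mkset _ = (fun y => enorm (y - x0)) @^-1` [set t | t <= r])//.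
apply: preimage_closed; last exact: closed_le.
by move=> x _; exact: enormB_continuous.
Qed.

(** The compactness step of both comparison arguments: a continuous function
    smaller on a sphere than at its centre has a local maximum inside. *)
Lemma interior_max {R : realType} n (A : set 'rV[R]_n) (F : 'rV[R]_n -> R)
    (x0 : 'rV[R]_n) (r : R) :
  0 <= r -> (forall y, enorm (y - x0) <= r -> A y) -> {in A, continuous F} ->
  (forall y, enorm (y - x0) = r -> F y < F x0) ->
  exists x, [/\ enorm (x - x0) < r, F x0 <= F x & \forall y \near x, F y <= F x].
Proof.
move=> r0 KA cF Fsphere; set K := [set y | enorm (y - x0) <= r].
have Kx0 : K x0 by rewrite /K /= subrr enorm0.
have [] := @EVT_max_rV _ _ F K.
- by exists x0.
- exact: compact_enorm_ball.
- apply: continuous_in_subspaceT => y /set_mem Ky; apply: cF.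
  by apply/mem_set/KA.
move=> x /set_mem /= Kx Fmax.
have Fx : F x0 <= F x by apply/Fmax/mem_set.
have xr : enorm (x - x0) < r.
  rewrite lt_neqAle Kx andbT; apply/eqP => /Fsphere.
  by rewrite ltNge Fx.
exists x; split => //.
apply: filterS (cvgr_lt _ (@enormB_continuous _ _ x0 x) r xr) => y /ltW yr.
exact/Fmax/mem_set.
Qed.

(** * Derivatives along lines *)

Lemma cvg_line {R : realType} {V : normedModType R} (x e : V) :
  x + t *: e @[t --> (0 : R)] --> x.
Proof.
rewrite -[X in _ --> X]addr0 -[X in _ --> _ + X](scale0r e).
by apply: cvgD; [exact: cvg_cst|apply: cvgZr_tmp; exact: cvg_id].
Qed.

Lemma near_line {R : realType} {V : normedModType R} (x e : V) (P : V -> Prop) :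
  (\forall y \near x, P y) -> \forall t \near (0 : R), P (x + t *: e).
Proof. by move=> xP; exact: (@cvg_line _ _ x e _ xP). Qed.

(** Both sides are limits of the same difference quotient. *)
Lemma is_derive_line {R : realType} {V W : normedModType R} (f : V -> W)
    (x e : V) (s : R) (df : W) :
  is_derive (x + s *: e) e f df -> is_derive s 1 (fun t => f (x + t *: e)) df.
Proof.
move=> [dfx dfE].
have E : (fun h : R => h^-1 *: (((fun t => f (x + t *: e)) \o shift s) (h *: 1)
                         - f (x + s *: e))) =
  (fun h : R => h^-1 *: ((f \o shift (x + s *: e)) (h *: e) - f (x + s *: e))).
  apply/funext => h /=; rewrite [h *: 1]mulr1.
  by rewrite scalerDl addrCA.
by split; rewrite /derivable /derive E.
Qed.

Lemma is_derive_mull {R : realType} (k : R) (f : R -> R) (x df : R) :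
  is_derive x 1 f df -> is_derive x 1 (fun t => k * f t) (k * df).
Proof. exact: is_deriveZ. Qed.

Lemma is_derive_mul {R : realType} (f g : R -> R) (x df dg : R) :
  is_derive x 1 f df -> is_derive x 1 g dg ->
  is_derive x 1 (fun t => f t * g t) (f x * dg + g x * df).
Proof. exact: is_deriveM. Qed.

Lemma is_derive_inv {R : realType} (f : R -> R) (x df : R) : f x != 0 ->
  is_derive x 1 f df -> is_derive x 1 (fun t => (f t)^-1) (- (f x) ^- 2 * df).
Proof. exact: is_deriveV. Qed.

Lemma is_derive_expR_comp {R : realType} (f : R -> R) (x df : R) :
  is_derive x 1 f df ->
  is_derive x 1 (fun t => expR (f t)) (expR (f x) * df).
Proof. by move=> D; exact: is_derive1_comp (is_derive_expR _) D. Qed.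

Lemma mvt_partial {R : realType} n (A : set 'rV[R]_n) (f : 'rV[R]_n -> R)
    (y : 'rV[R]_n) (i : 'I_n) (t : R) :
  C1_on A f -> (forall s, `|s| <= `|t| -> A (y + s *: delta_mx 0 i)) ->
  exists2 s, `|s| <= `|t| &
    f (y + t *: delta_mx 0 i) - f y = t * partial i f (y + s *: delta_mx 0 i).
Proof.
move=> [cf df] At.
set g := fun s => f (y + s *: delta_mx 0 i).
have D s : `|s| <= `|t| ->
    is_derive (s : R) 1 g (partial i f (y + s *: delta_mx 0 i)).
  move=> st; apply: is_derive_line; apply: derivableP.
  by have [+ _] := df i; apply; exact: At.
have g0 : g 0 = f y by rewrite /g scale0r addr0.
have [t0|t0] := leP 0 t.
- have ts s : s \in `[0, t]%R -> `|s| <= `|t|.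
    by rewrite in_itv/= => /andP[s0 st]; rewrite !ger0_norm.
  have [||s /ts st E] := @MVT_segment _ g
    (fun s => partial i f (y + s *: delta_mx 0 i)) 0 t t0.
  + by move=> s st; apply/D/ts/subset_itv_oo_cc.
  + by apply: derivable_within_continuous => s /ts /D[].
  by exists s => //; rewrite -g0 E subr0 mulrC.
- have ts s : s \in `[t, 0]%R -> `|s| <= `|t|.
    by rewrite in_itv/= => /andP[ts s0]; rewrite !ler0_norm ?lerN2// ltW.
  have [||s /ts st E] := @MVT_segment _ g
    (fun s => partial i f (y + s *: delta_mx 0 i)) t 0 (ltW t0).
  + by move=> s st; apply/D/ts/subset_itv_oo_cc.
  + by apply: derivable_within_continuous => s /ts /D[].
  by exists s => //; rewrite -g0 -opprB E sub0r mulrN opprK mulrC.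
Qed.

(** Continuity of the partial derivatives gives the chain rule: the increment
    along [e] is split into one step per axis, each of which is evaluated at
    an intermediate point by the mean value theorem. *)
Lemma is_derive_C1 {R : realType} (A : set 'rV[R]_2) (f : 'rV[R]_2 -> R)
    (x e : 'rV[R]_2) :
  open A -> A x -> C1_on A f ->
  is_derive x e f (\sum_i partial i f x * e 0 i).
Proof.
move=> oA Ax C1.
set L := \sum_i _.
suff C : (fun h => h^-1 *: ((f \o shift x) (h *: e) - f x)) @ 0^' --> L.
  by split; [apply/cvg_ex; exists L|exact: cvg_lim].
apply/cvgrPdist_le => eps eps0.
pose o1 : 'I_2 := lift ord0 ord0.
have o2P (i : 'I_2) : i = ord0 \/ i = o1.
  by case: (unliftP ord0 i) => [j ->|->]; [right; rewrite ord1|left].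
pose M := `|e 0 ord0| + `|e 0 o1| + 1.
have M0 : 0 < M by rewrite /M ltr_wpDl// addr_ge0.
have [d d0 Hd] : exists2 d, 0 < d & forall y, enorm (y - x) < d ->
    A y /\ forall i, `|partial i f x - partial i f y| <= eps / M.
  have H i : \forall y \near x, `|partial i f x - partial i f y| <= eps / M.
    have [_ /(_ i)[_ /(_ x (mem_set Ax))]] := C1.
    by move=> /cvgrPdist_le; apply; rewrite divr_gt0.
  have H0 := H ord0; have H1 := H o1.
  have Anear : \forall y \near x, A y by exact: open_nbhs_nbhs.
  have [d d0 Hd] := (near_enorm x _).1 (filterI Anear (filterI H0 H1)).
  exists d; first exact: d0.
  move=> y /Hd[Ay [P0 P1]]; split; first exact: Ay.
  by move=> i; have [->|->] := o2P i; [exact: P0|exact: P1].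
have small : \forall h \near (0 : R), `|h| * M < d.
  near=> h; rewrite -ltr_pdivlMr//; near: h.
  apply/nbhs_ballP; exists (d / M) => /=; first by rewrite divr_gt0.
  by move=> h; rewrite -ball_normE /= sub0r normrN.
near=> h.
have h0 : h != 0 by near: h; exact: nbhs_dnbhs_neq.
have hd : `|h| * M < d by near: h; exact: nbhs_dnbhs.
pose z := x + (h * e 0 ord0) *: delta_mx 0 ord0.
(* From [x] to [z] along the first axis, then to [x + h *: e] along the
   second. *)
have zE : x + h *: e = z + (h * e 0 o1) *: delta_mx 0 o1.
  apply/rowP => i; rewrite !mxE !eqxx /=.
  by have [->|->] := o2P i; rewrite /= ?mulr1 ?mulr0 ?addr0.
have dl (i : 'I_2) (s : R) : enorm (s *: delta_mx 0 i : 'rV[R]_2) = `|s|.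
  rewrite /enorm big_ord_recl big_ord1 !mxE.
  by have [->|->] := o2P i; rewrite /= mulr0 mulr1 expr0n ?addr0 ?add0r sqrtr_sqr.
have n0 s : `|s| <= `|h * e 0 ord0| ->
    enorm (x + s *: delta_mx 0 ord0 - x) < d.
  rewrite addrC addKr dl normrM => /le_lt_trans; apply.
  rewrite (le_lt_trans _ hd)// ler_wpM2l// /M -addrA lerDl addr_ge0//.
have n1 s : `|s| <= `|h * e 0 o1| ->
    enorm (z + s *: delta_mx 0 o1 - x) < d.
  move=> sh; rewrite /z addrAC [x + _]addrC addrK.
  rewrite (le_lt_trans (enormD _ _))// !dl (le_lt_trans (lerD (lexx _) sh))//.
  rewrite !normrM (le_lt_trans _ hd)// -mulrDr ler_wpM2l// /M lerDl//.
have [s0 /n0/Hd[_ /(_ ord0) P0] E0] :=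
  mvt_partial C1 (fun s sh => (Hd _ (n0 s sh)).1).
have [s1 /n1/Hd[_ /(_ o1) P1] E1] :=
  mvt_partial C1 (fun s sh => (Hd _ (n1 s sh)).1).
rewrite /= [h *: e + x]addrC zE.
rewrite -[f (z + _)](subrK (f z)) E1 -addrA E0.
rewrite /GRing.scale /= -!mulrA -mulrDr mulKf//.
rewrite /L big_ord_recl big_ord1.
move: P0 P1; set a0 := partial _ _ x; set b0 := partial ord0 f _.
set a1 := partial o1 f x; set b1 := partial o1 f _ => P0 P1.
have -> : a0 * e 0 ord0 + a1 * e 0 o1 - (e 0 o1 * b1 + e 0 ord0 * b0) =
  (a0 - b0) * e 0 ord0 + (a1 - b1) * e 0 o1 by ring.
rewrite (le_trans (ler_normD _ _))// !normrM.
rewrite (le_trans (lerD (ler_wpM2r _ P0) (ler_wpM2r _ P1)))//.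
rewrite -mulrDr mulrAC ler_pdivrMr// ler_pM2l// /M lerDl//.
Unshelve. all: by end_near. Qed.

(** * Second-order conditions at a touching point *)

(** If [l] were positive, [h1] would be positive just to the right of its zero
    [a], so [h] would increase there. *)
Lemma second_derivative_at_max {R : realType} (h h1 : R -> R) (a l : R) :
  (\forall t \near (a : R), is_derive (t : R) 1 h (h1 t)) -> is_derive a 1 h1 l ->
  (\forall t \near (a : R), h t <= h a) -> h1 a = 0 /\ l <= 0.
Proof.
move=> dh dh1 hmax.
have [e /= e0 He] : exists2 e : R, 0 < e & forall t, `|a - t| < e ->
    is_derive (t : R) 1 h (h1 t) /\ h t <= h a.
  have : \forall t \near (a : R), is_derive (t : R) 1 h (h1 t) /\ h t <= h a.
    by near=> t; split; near: t.
  by move=> /nbhs_ballP[e e0 He]; exists e => // t ?; apply: He.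
have inb t : t \in `](a - e), (a + e)[%R -> `|a - t| < e.
  by rewrite in_itv/= ltr_norml => /andP[? ?]; apply/andP; split; lra.
have h1a : h1 a = 0.
  have D : is_derive a 1 h 0.
    apply: (@derive1_at_max _ h (a - e) (a + e)).
    - lra.
    - by move=> t /inb /He[[]].
    - rewrite in_itv/=; apply/andP; split; lra.
    - by move=> t /inb /He[].
  have [[_ <-] _] : is_derive (a : R) 1 h (h1 a) /\ h a <= h a.
    by apply: He; rewrite subrr normr0.
  by rewrite derive_val.
split => //; rewrite leNgt; apply/negP => l0.
have : \forall d \near 0^', 0 < d^-1 *: (h1 (d *: 1 + a) - h1 a).
  case: dh1 => dh1 dh1E.
  have C : (fun d : R => d^-1 *: (h1 (d *: 1 + a) - h1 a)) @ 0^' --> l.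
    by rewrite -dh1E; exact: dh1.
  exact: (cvgr_gt l C).
move=> /nbhs_ballP[d /= d0 Hd].
set b := a + Num.min d e / 2.
have m0 : 0 < Num.min d e by rewrite lt_min d0.
have [md me] : Num.min d e <= d /\ Num.min d e <= e.
  by rewrite !ge_min !lexx orbT.
have ab : a < b by rewrite /b; lra.
have inb2 t : a <= t <= b -> `|a - t| < e.
  by rewrite /b ltr_norml => /andP[? ?]; apply/andP; split; lra.
have D t : a <= t <= b -> is_derive (t : R) 1 h (h1 t) by move=> /inb2 /He[].
have [c cab E] : exists2 c, c \in `]a, b[%R & h b - h a = h1 c * (b - a).
  apply: MVT => //.
    by move=> t; rewrite in_itv/= => /andP[? ?]; apply: D; rewrite !ltW.
  apply: derivable_within_continuous => t; rewrite in_itv/= => /D[//].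
move: cab; rewrite in_itv/= => /andP[ac cb].
have : 0 < h1 c.
  have ca : 0 < c - a by lra.
  have := Hd (c - a); rewrite /= h1a subr0 [(c - a) *: 1]mulr1 subrK.
  rewrite /GRing.scale/= pmulr_rgt0 ?invr_gt0//; apply.
    by rewrite -ball_normE /= sub0r normrN gtr0_norm// /b in cb *; lra.
  by rewrite gt_eqF.
move=> h1c; have : 0 < h b - h a by rewrite E mulr_gt0// subr_gt0.
have [_] : is_derive (b : R) 1 h (h1 b) /\ h b <= h a.
  by apply/He/inb2; rewrite lexx ltW.
lra.
Unshelve. all: by end_near.
Qed.

(** The second-derivative test for [f - E], where
    [E t = f 0 * expR (mu * (w t - w 0))] touches [f] from above at 0. *)
Lemma exp_touching_above {R : realType} (f f1 w w1 : R -> R) (mu l k : R) :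
  (\forall t \near (0 : R), is_derive (t : R) 1 f (f1 t)) -> is_derive (0 : R) 1 f1 l ->
  (\forall t \near (0 : R), is_derive (t : R) 1 w (w1 t)) -> is_derive (0 : R) 1 w1 k ->
  (\forall t \near (0 : R), f t * expR (- (mu * w t)) <= f 0 * expR (- (mu * w 0))) ->
  f1 0 = mu * w1 0 * f 0 /\ l <= (mu * k + (mu * w1 0) ^+ 2) * f 0.
Proof.
move=> df df1 dw dw1 fmax.
pose E t := f 0 * expR (mu * (w t - w 0)).
have dE t : is_derive (t : R) 1 w (w1 t) -> is_derive (t : R) 1 E (mu * w1 t * E t).
  move=> D.
  have := is_derive_mull mu (is_deriveB D (is_derive_cst (w 0) t 1)).
  rewrite subr0 => /is_derive_expR_comp/(is_derive_mull (f 0)) D1.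
  by apply: (is_derive_eq D1); rewrite /E; ring.
have E0 : E 0 = f 0 by rewrite /E subrr mulr0 expR0 mulr1.
pose h t := f t - E t.
pose h1 t := f1 t - mu * w1 t * E t.
have [] := @second_derivative_at_max _ h h1 0 (l - (mu * k + (mu * w1 0) ^+ 2) * f 0).
- near=> t; rewrite /h /h1; apply: is_deriveB; last apply: dE; near: t; assumption.
- have D1 := is_derive_mull mu dw1.
  have D2 := dE 0 (nbhs_singleton dw).
  have D3 := is_deriveB df1 (is_derive_mul D1 D2).
  apply: (is_derive_eq D3).
  rewrite E0; ring.
- near=> t; rewrite /h E0 subrr subr_le0 /E.
  rewrite mulrBr expRD mulrA mulrAC -ler_pdivrMr ?expR_gt0// -expRN.
  near: t; assumption.
- by rewrite /h1 E0 => h10 lk; split; lra.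
Unshelve. all: by end_near.
Qed.

(** Summation of the one-variable conditions over the coordinate axes. *)
Lemma laplacian_at_touching {R : realType} n (A : set 'rV[R]_n) (f w : 'rV[R]_n -> R)
    (x : 'rV[R]_n) (w1 : 'I_n -> R -> R) (k : 'I_n -> R) (mu : R) :
  open A -> A x -> C2_on A f ->
  (forall i, \forall t \near (0 : R),
    is_derive (t : R) 1 (fun t => w (x + t *: delta_mx 0 i)) (w1 i t)) ->
  (forall i, is_derive (0 : R) 1 (w1 i) (k i)) ->
  (\forall y \near x,
    f y * expR (- (mu * w y)) <= f x * expR (- (mu * w x))) ->
  (forall i, partial i f x = mu * w1 i 0 * f x) /\
  laplacian f x <=
    (mu * (\sum_i k i) + mu ^+ 2 * (\sum_i w1 i 0 ^+ 2)) * f x.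
Proof.
move=> oA Ax [[cf df] d2f] dw dw1 fmax.
have Anear : \forall y \near x, A y by exact: open_nbhs_nbhs.
have key i : partial i f x = mu * w1 i 0 * f x /\
    partial i (partial i f) x <= (mu * k i + (mu * w1 i 0) ^+ 2) * f x.
  have := @exp_touching_above _ (fun t => f (x + t *: delta_mx 0 i))
    (fun t => partial i f (x + t *: delta_mx 0 i))
    (fun t => w (x + t *: delta_mx 0 i)) (w1 i) mu
    (partial i (partial i f) x) (k i).
  rewrite !scale0r !addr0 => H; apply: {H} (H _ _ (dw i) (dw1 i)).
  - have := near_line (delta_mx 0 i) Anear.
    apply: filterS => t At; apply: is_derive_line; apply: derivableP.
    by have [+ _] := df i; apply.
  - apply: is_derive_line; rewrite scale0r addr0; apply: derivableP.
    by have [_ /(_ i)[+ _]] := d2f i; apply.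
  - exact: (near_line (delta_mx 0 i) fmax).
split; first by move=> i; case: (key i).
rewrite /laplacian (le_trans (ler_sum _ (fun i _ => (key i).2)))//.
rewrite -mulr_suml big_split/= -mulr_sumr.
by under eq_bigr do rewrite exprMn; rewrite -mulr_sumr.
Qed.

Lemma is_derive_quadratic {R : realType} (a b t : R) :
  is_derive t 1 (fun s => a + 2 * s * b + s ^+ 2) (2 * (b + t)).
Proof.
have D1 := is_derive_mull (2 * b) (is_derive_id t 1).
have D2 := is_derive_mul (is_derive_id t 1) (is_derive_id t 1).
have D := is_deriveD (is_deriveD (is_derive_cst a t 1) D1) D2.
have -> : (fun s => a + 2 * s * b + s ^+ 2) =
  (cst a + (fun s => 2 * b * s) + (fun s => s * s)).
  by apply/funext => s; rewrite -[RHS]/(a + 2 * b * s + s * s); ring.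
by apply: (is_derive_eq D); rewrite /=; ring.
Qed.

Lemma is_derive_sqrt_quadratic {R : realType} (a b t : R) :
  0 < a + 2 * t * b + t ^+ 2 ->
  is_derive t 1 (fun s => Num.sqrt (a + 2 * s * b + s ^+ 2))
    ((b + t) / Num.sqrt (a + 2 * t * b + t ^+ 2)).
Proof.
move=> q0.
have D := @is_derive1_comp _ Num.sqrt (fun s => a + 2 * s * b + s ^+ 2) t _ _
  (is_derive1_sqrt q0) (is_derive_quadratic a b t).
apply: (is_derive_eq D); rewrite /=; field.
by rewrite gt_eqF// sqrtr_gt0.
Qed.

Lemma is_derive_sqrt_quadratic2 {R : realType} (a b : R) : 0 < a ->
  is_derive (0 : R) 1 (fun s => (b + s) / Num.sqrt (a + 2 * s * b + s ^+ 2))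
    ((Num.sqrt a)^-1 - b ^+ 2 / Num.sqrt a ^+ 3).
Proof.
move=> a0.
have q0 : 0 < a + 2 * 0 * b + 0 ^+ 2 by rewrite mulr0 mul0r !addr0 expr0n addr0.
have D1 := is_derive_sqrt_quadratic q0.
have s0 : Num.sqrt (a + 2 * 0 * b + 0 ^+ 2) != 0 by rewrite gt_eqF// sqrtr_gt0.
have D2 :=
  @is_derive_inv _ (fun s => Num.sqrt (a + 2 * s * b + s ^+ 2)) 0 _ s0 D1.
have D := is_derive_mul
  (is_deriveD (is_derive_cst b (0 : R) (1 : R)) (is_derive_id (0 : R) (1 : R)))
  D2.
apply: (is_derive_eq D).
rewrite mulr0 mul0r !addr0 expr0n addr0. rewrite -[(cst b + id) 0]/(b + 0).
field.
by rewrite gt_eqF// sqrtr_gt0.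
Qed.

(** All comparison functions are exponentials of such a [w].  For [alpha > 0],
    [beta = 0] and [a > 0] it is a smoothed multiple of the distance to [c], with
    gradient shorter than [alpha]; for [alpha = -1] and [a = 0] it is minus
    that distance, corrected by a paraboloid centred at [q]. *)
Definition barrier {R : realType} {n} (alpha beta a : R) (c q x : 'rV[R]_n) :=
  alpha * Num.sqrt (a + sqnorm (x - c)) + beta * sqnorm (x - q).

Lemma barrier_continuous {R : realType} n (alpha beta a : R) (c q : 'rV[R]_n) :
  continuous (barrier alpha beta a c q).
Proof.
have S d : continuous (fun y : 'rV[R]_n => sqnorm (y - d)).
  move=> y; apply: (@continuous_comp _ _ _ (fun x : 'rV[R]_n => x - d) (@sqnorm R n)).
    by apply: continuousB; [exact: cvg_id|exact: cst_continuous].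
  exact: sqnorm_continuous.
move=> x; apply: (@continuousD _ _ _
  (fun x : 'rV[R]_n => alpha * Num.sqrt (a + sqnorm (x - c)))
  (fun x : 'rV[R]_n => beta * sqnorm (x - q))).
  apply: continuousM; first exact: cst_continuous.
  apply: (@continuous_comp _ _ _ (fun x : 'rV[R]_n => a + sqnorm (x - c)) Num.sqrt).
    by apply: continuousD; [exact: cst_continuous|exact: S].
  exact: sqrt_continuous.
by apply: continuousM; [exact: cst_continuous|exact: S].
Qed.

(** Here [g] is the gradient of the barrier and the factor of [mu] its
    laplacian; the equation turns the bound on the laplacian of [f] into a
    relation between these two alone, as [f x] cancels. *)
Lemma barrier_touching {R : realType} n (A : set 'rV[R]_n) (f : 'rV[R]_n -> R)
    (alpha beta a : R) (c q x : 'rV[R]_n) (mu : R) :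
  let h := Num.sqrt (a + sqnorm (x - c)) in
  let w := barrier alpha beta a c q in
  let g i := alpha * (x 0 i - c 0 i) / h + 2 * beta * (x 0 i - q 0 i) in
  open A -> A x -> C2_on A f -> 0 < a + sqnorm (x - c) ->
  laplacian f x - mu ^+ 2 * f x = 0 -> 0 < f x ->
  (\forall y \near x,
    f y * expR (- (mu * w y)) <= f x * expR (- (mu * w x))) ->
  (forall i, partial i f x = mu * g i * f x) /\
  mu ^+ 2 <= mu * (alpha * (n%:R / h - sqnorm (x - c) / h ^+ 3) + 2 * n%:R * beta)
    + mu ^+ 2 * (\sum_i g i ^+ 2).
Proof.
move=> h w g oA Ax Cf h0 pde fx0 fmax.
have sl d i t : sqnorm (x + t *: delta_mx 0 i - d) =
    sqnorm (x - d) + 2 * t * (x 0 i - d 0 i) + t ^+ 2.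
  by rewrite addrAC sqnorm_line !mxE.
pose Q i t := a + sqnorm (x - c) + 2 * t * (x 0 i - c 0 i) + t ^+ 2.
pose w1 i t := alpha * ((x 0 i - c 0 i + t) / Num.sqrt (Q i t))
   + beta * (2 * (x 0 i - q 0 i + t)).
pose k i := alpha * (h^-1 - (x 0 i - c 0 i) ^+ 2 / h ^+ 3) + beta * 2.
have w1g i : w1 i 0 = g i.
  rewrite /w1 /Q /g !addr0 mulr0 mul0r expr0n !addr0 -/h; ring.
have [] := @laplacian_at_touching _ _ A f w x w1 k mu oA Ax Cf.
- move=> i.
  have wE : (fun t => w (x + t *: delta_mx 0 i)) =
      (fun t => alpha * Num.sqrt (Q i t)) +
      (fun t => beta * (sqnorm (x - q) + 2 * t * (x 0 i - q 0 i) + t ^+ 2)).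
    by apply/funext => t; rewrite /w /barrier !sl /Q !addrA.
  have Qc : Q i t @[t --> (0 : R)] --> Q i 0.
    have D := is_derive_quadratic (a + sqnorm (x - c)) (x 0 i - c 0 i) 0.
    have /derivable1_diffP/differentiable_continuous : derivable (Q i) 0 1.
      by case: D.
    by apply.
  have Q0 : 0 < Q i 0 by rewrite /Q mulr0 mul0r expr0n !addr0.
  have Qpos : \forall t \near (0 : R), 0 < Q i t by exact: (cvgr_gt (Q i 0) Qc 0 Q0).
  near=> t; have Qt : 0 < Q i t by near: t.
  rewrite wE; apply: is_deriveD.
    by apply: is_derive_mull; exact: is_derive_sqrt_quadratic.
  by apply: is_derive_mull; exact: is_derive_quadratic.
- move=> i; apply: is_deriveD.
    by apply: is_derive_mull; exact: is_derive_sqrt_quadratic2.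
  apply: is_derive_mull.
  have D := is_derive_mull 2 (is_deriveD
    (is_derive_cst (x 0 i - q 0 i) (0 : R) (1 : R))
    (is_derive_id (0 : R) (1 : R))).
  by apply: (is_derive_eq D); rewrite add0r mulr1.
- exact: fmax.
move=> pE lapf; split; first by move=> i; rewrite pE w1g.
have lapE : laplacian f x = mu ^+ 2 * f x by apply/eqP; rewrite -subr_eq0 pde.
move: lapf; rewrite lapE ler_pM2r// => /le_trans; apply.
under [X in _ + _ * X <= _]eq_bigr do rewrite w1g.
rewrite lerD2r /k big_split/= -mulr_sumr sumrB -mulr_suml.
rewrite !sumr_const card_ord /sqnorm.
under [in leRHS]eq_bigr do rewrite !mxE.
rewrite le_eqVlt; apply/orP; left; apply/eqP; rewrite -[h^-1 *+ n]mulr_natl.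
rewrite -[beta * 2 *+ n]mulr_natl; ring.
Unshelve. all: by end_near. Qed.

(** * Exponential decay of solutions away from the boundary *)

(** At an interior maximum with value above 1 the laplacian would be
    nonpositive, yet equal to [mu ^+ 2 * f x > 0]. *)
Lemma max_principle {R : realType} n (D : set 'rV[R]_n) (mu : R)
    (f : 'rV[R]_n -> R) :
  open D -> bounded_set D -> 0 < mu -> dirichlet_solution D mu f ->
  forall x, D x -> f x <= 1.
Proof.
move=> oD bD mu0 [C2 cf pde bc] x Dx.
have cD : compact (closure D).
  apply: bounded_closed_compact; last exact: closed_closure.
  case: bD => M [Mr HM]; exists M; split => // N MN y Dy.
  have clN : closed [set z : 'rV[R]_n | `|z| <= N].
    by apply: (@preimage_closed _ _ (fun z : 'rV[R]_n => `|z|) [set t | t <= N]);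
      [move=> z _; exact: norm_continuous|exact: closed_le].
  have : closure D `<=` [set z : 'rV[R]_n | `|z| <= N].
    by move/closure_id: clN => ->; apply: closure_subset => z /(HM _ MN).
  by apply.
have [|c /set_mem Dc fmax] := EVT_max_rV _ cD cf.
  by exists x; exact: subset_closure.
rewrite (le_trans (fmax _ (mem_set (subset_closure Dx))))// leNgt.
apply/negP => c1.
have {}Dc : D c.
  apply: contrapT => nDc; move: c1; rewrite bc ?ltxx//; split => // /interior_subset.
  exact: nDc.
have [] := @laplacian_at_touching _ _ D f (fun=> 0) c (fun _ _ => 0) (fun=> 0) mu
  oD Dc C2.
- by move=> i; near=> t; exact: is_derive_cst.
- have Dnear : \forall y \near c, D y by exact: open_nbhs_nbhs.
  near=> y; have Dy : D y by near: y.
  rewrite ler_pM2r ?expR_gt0//.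
  by apply/fmax/mem_set/subset_closure.
move=> _; have /eqP := pde _ Dc; rewrite subr_eq0 => /eqP ->.
rewrite !big1 ?mulr0 ?addr0 ?mul0r//; last by move=> *; rewrite expr0n.
by rewrite leNgt mulr_gt0 ?exprn_gt0// (lt_trans _ c1).
Unshelve. all: by end_near. Qed.

(** Suppose the bound fails.  Then [f * expR (- mu w)], with [w] a smoothed
    multiple [alpha] of the distance to [x0], is larger at [x0] than on the
    sphere of radius [r], where [f <= 1].  At the resulting interior maximum
    [barrier_touching] requires [mu ^+ 2] to be at most
    [mu * laplacian w + mu ^+ 2 * alpha ^+ 2], which the lower bound on [mu]
    excludes.  Since [alpha] may be close to 1 and [sigma] to 0, the decay
    rate in [r] is asymptotically sharp. *)
Lemma ball_decay {R : realType} n (A : set 'rV[R]_n) (f : 'rV[R]_n -> R)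
    (mu alpha sigma r : R) (x0 : 'rV[R]_n) :
  open A -> C2_on A f ->
  (forall x, A x -> laplacian f x - mu ^+ 2 * f x = 0) ->
  (forall x, A x -> f x <= 1) ->
  0 < mu -> 0 < alpha -> 0 < sigma ->
  n%:R * alpha / sigma < mu * (1 - alpha ^+ 2) ->
  0 <= r -> (forall y, enorm (y - x0) <= r -> A y) ->
  f x0 <= expR (- (mu * (alpha * (r - sigma)))).
Proof.
move=> oA Cf pde f1 mu0 al0 sg0 hmu r0 KA; rewrite leNgt; apply/negP => fx0.
pose w := barrier alpha 0 (sigma ^+ 2) x0 x0.
pose F y := f y * expR (- (mu * w y)).
have wE y : w y = alpha * Num.sqrt (sigma ^+ 2 + enorm (y - x0) ^+ 2).
  by rewrite /w /barrier mul0r addr0 enorm_sqr.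
have wx0 : w x0 = alpha * sigma.
  by rewrite wE subrr enorm0 expr0n addr0 sqrtr_sqr gtr0_norm.
have cF : {in A, continuous F}.
  move=> y Ay; apply: (@continuousM _ _ f (fun y => expR (- (mu * w y)))).
    by have [[cf _] _] := Cf; exact: cf.
  apply: (@continuous_comp _ _ _ (fun y : 'rV[R]_n => - (mu * w y)) expR).
    apply: continuousN; apply: continuousM; first exact: cst_continuous.
    exact: barrier_continuous.
  exact: continuous_expR.
have Fsphere y : enorm (y - x0) = r -> F y < F x0.
  move=> yr; apply: (@le_lt_trans _ _ (expR (- (mu * (alpha * r))))).
    apply: (@le_trans _ _ (1 * expR (- (mu * w y)))).
      by rewrite ler_pM2r ?expR_gt0// f1//; apply: KA; rewrite yr.
    rewrite mul1r ler_expR lerN2 ler_pM2l// wE yr ler_pM2l//.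
    by rewrite (le_trans (ler_norm _))// -sqrtr_sqr ler_wsqrtr// lerDr sqr_ge0.
  rewrite /F wx0.
  have -> : - (mu * (alpha * r)) =
    - (mu * (alpha * (r - sigma))) + - (mu * (alpha * sigma)) by ring.
  by rewrite expRD ltr_pM2r ?expR_gt0.
have [x [xr Fx xmax]] := interior_max r0 KA cF Fsphere.
have Ax : A x by apply/KA/ltW.
have fx : 0 < f x.
  have : 0 < F x.
    rewrite (lt_le_trans _ Fx)// mulr_gt0 ?expR_gt0// (lt_trans _ fx0)//.
    exact: expR_gt0.
  by rewrite pmulr_lgt0 ?expR_gt0.
have S0 := sqnorm_ge0 (x - x0).
have h0 : 0 < sigma ^+ 2 + sqnorm (x - x0) by rewrite ltr_pwDl ?exprn_gt0.
have [_] := barrier_touching oA Ax Cf h0 (pde _ Ax) fx xmax.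
set h := Num.sqrt _; rewrite !mulr0 addr0.
have hp : 0 < h by rewrite sqrtr_gt0.
have hsg : sigma <= h.
  by rewrite -[leLHS]gtr0_norm// -sqrtr_sqr ler_wsqrtr// lerDl.
under eq_bigr do rewrite mul0r addr0 exprMn exprMn.
have -> : \sum_(i < n) alpha ^+ 2 * (x 0 i - x0 0 i) ^+ 2 * h^-1 ^+ 2 =
    alpha ^+ 2 * (sqnorm (x - x0) / h ^+ 2).
  rewrite -mulr_suml -mulr_sumr -mulrA exprVn /sqnorm.
  by under [in RHS]eq_bigr do rewrite !mxE.
have hE : h ^+ 2 = sigma ^+ 2 + sqnorm (x - x0) by rewrite sqr_sqrtr// ltW.
(* The gradient of [w] has norm at most [alpha], its laplacian is at most
   [alpha * n / sigma]. *)
have q1 : sqnorm (x - x0) / h ^+ 2 <= 1.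
  by rewrite ler_pdivrMr ?exprn_gt0// mul1r hE lerDr sqr_ge0.
have nh : n%:R / h - sqnorm (x - x0) / h ^+ 3 <= n%:R / sigma.
  apply: (@le_trans _ _ (n%:R / h)); first by rewrite gerBl divr_ge0// exprn_ge0// ltW.
  by rewrite ler_wpM2l// lef_pV2.
move=> H.
suff : mu * (alpha * (n%:R / h - sqnorm (x - x0) / h ^+ 3)) +
   mu ^+ 2 * (alpha ^+ 2 * (sqnorm (x - x0) / h ^+ 2)) < mu ^+ 2.
  by rewrite ltNge H.
apply: (@le_lt_trans _ _ (mu * (alpha * (n%:R / sigma)) + mu ^+ 2 * (alpha ^+ 2 * 1))).
  by apply: lerD; rewrite ?ler_pM2l ?exprn_gt0.
move: hmu; rewrite -(ltr_pM2l mu0); lra.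
Qed.

(** By the gradient bound, [s |-> f (p + s *: e) * expR (mu * s)] is
    nondecreasing, and it tends to [f p = 1] as [s] decreases to 0. *)
Lemma decay_along_segment {R : realType} (D : set 'rV[R]_2) (f : 'rV[R]_2 -> R)
    (mu t : R) (p e : 'rV[R]_2) :
  open D -> C1_on D f -> {within closure D, continuous f} -> 0 < mu ->
  (forall x, D x -> enorm (grad f x) <= mu * f x) ->
  closure D p -> f p = 1 -> enorm e = 1 -> 0 < t ->
  (forall s, 0 < s -> s <= t -> D (p + s *: e)) ->
  expR (- (mu * t)) <= f (p + t *: e).
Proof.
move=> oD C1 cf mu0 gradf Dp fp e1 t0 Dseg.
have f0 x : D x -> 0 <= f x.
  by move=> /gradf /(le_trans (enorm_ge0 _)); rewrite pmulr_rge0.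
pose G s := f (p + s *: e) * expR (mu * s).
pose G1 s := f (p + s *: e) * (expR (mu * s) * mu) +
   expR (mu * s) * (\sum_i partial i f (p + s *: e) * e 0 i).
have dG s : 0 < s -> s <= t -> is_derive (s : R) 1 G (G1 s).
  move=> s0 st; apply: is_derive_mul.
    by apply: is_derive_line; exact: (is_derive_C1 e oD (Dseg s s0 st) C1).
  have D1 := is_derive_expR_comp (is_derive_mull mu (is_derive_id (s : R) (1 : R))).
  by apply: (is_derive_eq D1); rewrite mulr1.
have G1ge0 s : 0 < s -> s <= t -> 0 <= G1 s.
  move=> s0 st; rewrite /G1 mulrCA -mulrDr mulr_ge0 ?expR_ge0//.
  have := gradf _ (Dseg _ s0 st).
  have := cauchy_schwarz_enorm (- grad f (p + s *: e)) e.
  rewrite enormN e1 mulr1 => CS gr.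
  rewrite mulrC -lerBlDr sub0r (le_trans _ gr)// (le_trans _ CS)//.
  rewrite -sumrN; apply: ler_sum => i _; rewrite !mxE mulNr//.
have Gmono s : 0 < s -> s < t -> G s <= G t.
  move=> s0 st.
  have sub x : x \in `[s, t]%R -> 0 < x /\ x <= t.
    by rewrite in_itv/= => /andP[sx ->]; rewrite (lt_le_trans s0).
  have [||c cst E] := @MVT_segment _ G G1 s t (ltW st).
  - by move=> x /subset_itv_oo_cc /sub[]; exact: dG.
  - by apply: derivable_within_continuous => x /sub[x0 xt]; case: (dG _ x0 xt).
  have [c0 ct] := sub _ cst.
  by rewrite -subr_ge0 E mulr_ge0 ?G1ge0// subr_ge0 ltW.
(* The derivative at 0 need not exist, so the limit is replaced by a value
   at a small [s], where [f] is close to [f p] by continuity on the closure. *)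
suff : 1 <= G t by rewrite /G expRN -ler_pdivrMr ?expR_gt0// div1r.
rewrite leNgt; apply/negP => Gt1.
have cp := (subspace_continuousP _ _).1 cf p Dp.
have /near_enorm[d d0 Hd] : \forall y \near p, closure D y -> G t < f y.
  by apply: (cvgr_gt (f p) cp); rewrite fp.
pose s := Num.min d t / 2.
have m0 : 0 < Num.min d t by rewrite lt_min d0.
have [md mt] : Num.min d t <= d /\ Num.min d t <= t.
  by rewrite !ge_min !lexx orbT.
have s0 : 0 < s by rewrite /s; lra.
have st : s < t by rewrite /s; lra.
have Ds := Dseg _ s0 (ltW st).
have : G t < f (p + s *: e).
  apply: Hd; last exact: subset_closure.
  by rewrite addrC addKr enormZ e1 mulr1 gtr0_norm// /s; lra.
rewrite ltNge => /negP; apply; rewrite (le_trans _ (Gmono _ s0 st))//.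
by rewrite /G ler_peMr ?f0// -expR0 ler_expR mulr_ge0// ltW.
Qed.

(** * Nonconvex domains are touched from outside a disc *)

Definition visible {R : realType} {V : normedModType R} (D : set V) (x : V) :=
  [set y | forall t : R, 0 <= t -> t <= 1 -> D (x + t *: (y - x))].

(** Compactness of the segment from [x] to [y]. *)
Lemma visible_open {R : realType} {V : normedModType R} (D : set V) (x : V) :
  open D -> open (visible D x).
Proof.
move=> oD; rewrite openE => y xy.
have := (compact_near_coveringP _).1 (@segment_compact R 0 1) V (nbhs y)
  (fun z t => D (x + t *: (z - x))) _.
have cover (t : R) : `[0, 1]%classic t ->
    \forall t' \near t & z \near nbhs y, D (x + t' *: (z - x)).
  rewrite /= in_itv/= => /andP[t0 t1].
  have C : (fun q : R * V => x + q.1 *: (q.2 - x)) @ (nbhs t, nbhs y) -->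
      x + t *: (y - x).
    apply: cvgD; first exact: cvg_cst.
    apply: cvgZ; first exact: cvg_fst.
    by apply: cvgB; [exact: cvg_snd|exact: cvg_cst].
  apply: C; apply: open_nbhs_nbhs; split => //; exact: xy.
move=> /(_ _ cover); apply: filterS => z H t t0 t1; apply: H.
by rewrite /= in_itv/= t0.
Qed.

(** Otherwise the part of [D] visible from any [x] in [D] would be both open
    and closed in the connected set [D]. *)
Lemma nonconvex_visible {R : realType} {V : normedModType R} (D : set V) :
  open D -> connected D -> ~ convex_set D ->
  exists x y, [/\ D x, D y, closure (visible D x) y & ~ visible D x y].
Proof.
move=> oD cD; apply: contra_notP => H x y l /set_mem Dx /set_mem Dy.
suff E : D `&` visible D x = D.
  have [_ /(_ (1 - l%:num))] : (D `&` visible D x) y by rewrite E.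
  rewrite subr_ge0 gerBl le1 ge0 => /(_ isT isT).
  have -> : x + (1 - l%:num) *: (y - x) = conv l (x : convex_lmodType V) y.
    rewrite -[RHS]/(l%:num *: x + (1 - l%:num) *: y) scalerBr [in RHS]addrC.
    by rewrite addrCA; congr (_ + _); rewrite scalerBl scale1r opprB addrC subrK.
  exact: mem_set.
apply: cD.
- exists x; split => // t _ _; by rewrite subrr scaler0 addr0.
- by exists (visible D x) => //; exact: visible_open.
- exists (closure (visible D x)); first exact: closed_closure.
  apply/seteqP; split => z [Dz]; first by move/subset_closure.
  move=> clz; split => //; apply: contrapT => nz.
  by apply: H; exists x, z.
Qed.

(** Take [x], [y] from [nonconvex_visible], and [y'] visible from [x] and
    close to [y].  In the affine coordinates [z = x + S z *: u + T z *: f],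
    with [u = y - x] and [f = y' - y], let [N] be the trapezoid
    [0 <= S <= 1], [- 1 <= T <= S].  Its top side is [[x, y']] and its
    lateral sides are close to [x] or [y], so these three lie in [D]; the
    complement of [D] meets [N] on [[x, y]].  The centre [c] is so far away
    from [[x, y]], opposite to [y'], that the bottom side of [N] is nearer
    to [c] than [[x, y]] is.  Hence the point of [N] outside [D] that is
    farthest from [c] is interior to [N], and all points of [N] even
    farther from [c] are in [D]. *)
Lemma contact_from_outside_disc {R : realType} (D : set 'rV[R]_2) :
  open D -> connected D -> ~ convex_set D ->
  exists c p d, [/\ closure D p, ~ D p, 0 < enorm (p - c), 0 < d &
    forall y, enorm (y - p) < d -> enorm (p - c) < enorm (y - c) -> D y].
Proof.
move=> oD cD nD; have [x [y [Dx Dy cly nvis]]] := nonconvex_visible oD cD nD.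
have [e e0 [ballx bally]] : exists2 e, 0 < e &
    (forall z, enorm (z - x) < e -> D z) /\ (forall z, enorm (z - y) < e -> D z).
  have [e1 e10 B1] := (near_enorm x D).1 (open_nbhs_nbhs (conj oD Dx)).
  have [e2 e20 B2] := (near_enorm y D).1 (open_nbhs_nbhs (conj oD Dy)).
  exists (Num.min e1 e2); first by rewrite lt_min e10.
  by split=> z; rewrite lt_min => /andP[z1 z2]; [exact: B1|exact: B2].
have [s0 s00 [s01 nDz0]] : exists2 s, 0 <= s & s <= 1 /\ ~ D (x + s *: (y - x)).
  apply: contra_notP nvis => H t t0 t1; apply: contrapT => nDt.
  by apply: H; exists t.
have [y' [vis yy']] : exists y', visible D x y' /\ enorm (y' - y) < e.
  have /cly [z [vz]] : nbhs y [set z | enorm (z - y) < e].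
    by apply/near_enorm; exists e.
  by exists z.
have [u uE] : exists u, u = y - x by exists (y - x).
have [f fE] : exists f, f = y' - y by exists (y' - y).
have ufE : y' - x = u + f by rewrite uE fE [y - x + _]addrC addrA subrK.
move: nDz0 vis yy'; rewrite /visible /= -uE -fE ufE => nDz0 vis nf.
pose det (a b : 'rV[R]_2) := a 0 0 * b 0 1 - a 0 1 * b 0 0.
(* If [u] and [f] were parallel, the segment from [x] to [y'] and the ball
   around [y] would cover the segment from [x] to [y]. *)
have det0 : det u f != 0.
  apply/eqP => duf; apply: nDz0.
  have [u0|u0] := eqVneq u 0; first by rewrite u0 scaler0 addr0.
  have [k fk] : exists k, f = k *: u.
    have su0 : sqnorm u != 0.
      by rewrite -enorm_sqr sqrf_eq0; apply: contra_neq u0; exact: enorm_eq0.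
    exists ((u 0 0 * f 0 0 + u 0 1 * f 0 1) / sqnorm u).
    apply: row2P; rewrite !mxE mulrAC; apply: (canRL (mulfK su0));
      rewrite sqnorm2; apply/eqP; rewrite -subr_eq0; apply/eqP.
      by transitivity (- u 0 1 * det u f);
        [rewrite /det; ring|rewrite duf mulr0].
    by transitivity (u 0 0 * det u f); [rewrite /det; ring|rewrite duf mulr0].
  move: vis nf; rewrite fk -[X in X + _]scale1r -scalerDl => vis nf.
  have [sk|ks] := ltP s0 (1 + k).
    have k0 : 0 < 1 + k by lra.
    have := vis (s0 / (1 + k)).
    rewrite scalerA divfK ?gt_eqF//; apply.
      by rewrite divr_ge0// ltW.
    by rewrite ler_pdivrMr// mul1r ltW.
  apply: bally; apply: le_lt_trans nf.
  have -> : x + s0 *: u - y = (s0 - 1) *: u.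
    by rewrite scalerBl scale1r addrAC -[x - y]opprB -uE addrC.
  rewrite !enormZ ler_wpM2r ?enorm_ge0// !ler0_norm; lra.
set dl := det u f in det0.
pose S z := det (z - x) f / dl.
pose T z := det u (z - x) / dl.
have zE z : z = x + (S z *: u + T z *: f).
  by apply: row2P; rewrite !mxE /S /T /det !mxE; move: det0; rewrite /dl /det => det0; field.
have ST s t : S (x + (s *: u + t *: f)) = s /\ T (x + (s *: u + t *: f)) = t.
  rewrite /S /T [x + _]addrC addrK /det !mxE; move: det0; rewrite /dl /det => det0.
  by split; field.
have cc i : continuous (fun z : 'rV[R]_2 => (z - x) 0 i).
  move=> z; apply: (@continuous_comp _ _ _ (fun z : 'rV[R]_2 => z - x)
    (fun z : 'rV[R]_2 => z 0 i)); last exact: coord_continuous.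
  by apply: continuousB; [exact: cvg_id|exact: cst_continuous].
have cS : continuous S.
  move=> z; apply: (@continuousM _ _ (fun z => det (z - x) f) (cst dl^-1));
    last exact: cst_continuous.
  apply: (@continuousB _ _ _ (fun z : 'rV[R]_2 => (z - x) 0 0 * f 0 1)
    (fun z : 'rV[R]_2 => (z - x) 0 1 * f 0 0)).
    by apply: continuousM; [exact: cc|exact: cst_continuous].
  by apply: continuousM; [exact: cc|exact: cst_continuous].
have cT : continuous T.
  move=> z; apply: (@continuousM _ _ (fun z => det u (z - x)) (cst dl^-1));
    last exact: cst_continuous.
  apply: (@continuousB _ _ _ (fun z : 'rV[R]_2 => u 0 0 * (z - x) 0 1)
    (fun z : 'rV[R]_2 => u 0 1 * (z - x) 0 0)).
    by apply: continuousM; [exact: cst_continuous|exact: cc].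
  by apply: continuousM; [exact: cst_continuous|exact: cc].
pose B := enorm u + enorm f.
pose N := [set z | [/\ 0 <= S z, S z <= 1, - 1 <= T z & T z <= S z]].
have NB z : N z -> enorm (z - x) <= B.
  move=> [S0 S1 T0 TS]; rewrite [in z - x](zE z) addrC addKr.
  rewrite (le_trans (enormD _ _))// !enormZ; apply: lerD.
    by rewrite ger0_norm// ler_piMl// enorm_ge0.
  by rewrite ler_piMl ?enorm_ge0// ler_norml T0 (le_trans TS).
have compZ : compact (N `&` ~` D).
  apply: (@subclosed_compact _ _ [set z | enorm (z - x) <= B]).
  - apply: closedI; last by rewrite closedC.
    have c1 : closed [set z | 0 <= S z].
      by apply: (@preimage_closed _ _ S [set t | 0 <= t]);
        [move=> z _; exact: cS|exact: closed_ge].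
    have c2 : closed [set z | S z <= 1].
      by apply: (@preimage_closed _ _ S [set t | t <= 1]);
        [move=> z _; exact: cS|exact: closed_le].
    have c3 : closed [set z | - 1 <= T z].
      by apply: (@preimage_closed _ _ T [set t | -1 <= t]);
        [move=> z _; exact: cT|exact: closed_ge].
    have c4 : closed [set z | 0 <= S z - T z].
      apply: (@preimage_closed _ _ (S - T) [set t | 0 <= t]); last exact: closed_ge.
      by move=> z _; apply: continuousB; [exact: cS|exact: cT].
    have -> : N = [set z | 0 <= S z] `&` [set z | S z <= 1] `&`
        ([set z | - 1 <= T z] `&` [set z | 0 <= S z - T z]).
      apply/seteqP; split => z /=; first by move=> [? ? ? ?]; rewrite subr_ge0.
      by rewrite subr_ge0 => -[[? ?] [? ?]].
    by apply: closedI; apply: closedI.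
  - exact: compact_enorm_ball.
  - by move=> z [/NB].
(* [M] makes [2 * M * dl ^+ 2] exceed [B ^+ 2]: on the bottom side, where
   [T = - 1], the linear term of [QE] then outweighs the square of the
   distance to [x]. *)
pose M := (B ^+ 2 + 1) / (2 * dl ^+ 2).
have dl2 : 0 < dl ^+ 2 by rewrite lt_neqAle sqr_ge0 andbT eq_sym sqrf_eq0.
have M0 : 0 < M.
  by apply: divr_gt0; [exact: ltr_wpDl (sqr_ge0 _) ltr01|exact: mulr_gt0].
(* [n] is orthogonal to [u], and its product with [f] is [dl ^+ 2]. *)
have [n [n0 n1]] : exists n : 'rV[R]_2,
    n 0 0 = - (dl * u 0 1) /\ n 0 1 = dl * u 0 0.
  exists (\row_i (if i == 0 then - (dl * u 0 1) else dl * u 0 0)).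
  by rewrite !mxE.
pose c := x - M *: n.
have QE z : enorm (z - c) ^+ 2 =
    enorm (z - x) ^+ 2 + 2 * M * (T z * dl ^+ 2) + M ^+ 2 * enorm n ^+ 2.
  rewrite !enorm_sqr !sqnorm2 /c !mxE n0 n1 /T /det !mxE -/dl.
  by field.
pose z0 := x + s0 *: u.
have Sz0 : S z0 = s0 /\ T z0 = 0.
  by have := ST s0 0; rewrite scale0r addr0.
have Zz0 : (N `&` ~` D) z0.
  split => //; case: Sz0 => Es Et; rewrite /N /= Es Et; split => //; lra.
have [||p /set_mem [[S0 S1 T0 TS] nDp] pmax] :=
  @EVT_max_rV _ _ (fun z => enorm (z - c)) _ _ compZ.
- by exists z0.
- apply: continuous_in_subspaceT => z _; exact: enormB_continuous.
have pz0 : enorm (z0 - c) ^+ 2 <= enorm (p - c) ^+ 2.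
  by rewrite ler_pXn2r ?nnegrE ?enorm_ge0//; apply/pmax/mem_set.
have nn : 0 < enorm n ^+ 2.
  rewrite lt_neqAle sqr_ge0 andbT eq_sym sqrf_eq0.
  apply: contraTneq dl2 => /enorm_eq0 nE.
  have -> : dl ^+ 2 = n 0 0 * f 0 0 + n 0 1 * f 0 1.
    by rewrite n0 n1 /dl /det; ring.
  by rewrite nE !mxE !mul0r addr0 ltxx.
have pc0 : 0 < enorm (p - c).
  rewrite lt_neqAle enorm_ge0 andbT eq_sym; apply/eqP => pc.
  move: pz0; rewrite pc expr0n /= leNgt QE => /negP; apply.
  case: Sz0 => _ ->; rewrite mul0r mulr0 addr0.
  by rewrite ltr_wpDl ?sqr_ge0// mulr_gt0// exprn_gt0.
have T1 : - 1 < T p.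
  rewrite lt_neqAle T0 andbT; apply/eqP => Tp.
  move: pz0; rewrite !QE lerD2r -Tp; case: Sz0 => _ ->.
  rewrite mul0r mulr0 addr0 mulN1r mulrN.
  have -> : 2 * M * dl ^+ 2 = B ^+ 2 + 1.
    by rewrite /M; field.
  have := NB p; rewrite -(@ler_pXn2r _ 2) ?nnegrE ?enorm_ge0 ?addr_ge0 ?enorm_ge0//.
  move=> /(_ (And4 S0 S1 T0 TS)) pB.
  have := sqr_ge0 (enorm (z0 - x)); lra.
have ballT t : - 1 <= t -> t <= 1 -> enorm (t *: f) < e.
  move=> t0 t1; rewrite enormZ (le_lt_trans _ nf)// ler_piMl ?enorm_ge0//.
  by rewrite ler_norml t0.
have S0' : 0 < S p.
  rewrite lt_neqAle S0 andbT; apply/eqP => Sp; apply: nDp.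
  by apply: ballx; rewrite (zE p) -Sp scale0r add0r addrC addKr ballT//; lra.
have S1' : S p < 1.
  rewrite lt_neqAle S1 andbT; apply/eqP => Sp; apply: nDp.
  apply: bally; rewrite (zE p) Sp scale1r addrA uE [x + _]addrC subrK. rewrite addrAC.
  by rewrite subrr add0r ballT//; lra.
have TS' : T p < S p.
  rewrite lt_neqAle TS andbT; apply/eqP => TSp; apply: nDp.
  by rewrite (zE p) TSp -scalerDr; apply: vis.
have Nnear : \forall z \near p, N z.
  have c1 := cvgr_gt _ (cS p) _ S0'.
  have c2 := cvgr_lt _ (cS p) _ S1'.
  have c3 := cvgr_gt _ (cT p) _ T1.
  have c4 : \forall z \near p, 0 < (S - T) z.
    have C : {for p, continuous (S - T)}.
      by apply: continuousB; [exact: cS|exact: cT].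
    have ST0 : 0 < (S - T) p by rewrite subr_gt0.
    exact: (cvgr_gt ((S - T) p) C 0 ST0).
  near=> z; split; apply/ltW; [near: z; exact: c1|near: z; exact: c2|
    near: z; exact: c3|].
  by rewrite -subr_gt0; near: z; exact: c4.
have [d d0 Hd] := (near_enorm p N).1 Nnear.
have contact z : enorm (z - p) < d -> enorm (p - c) < enorm (z - c) -> D z.
  move=> /Hd Nz; apply: contraPP => nDz; apply/negP; rewrite -leNgt.
  by apply/pmax/mem_set.
(* Points on the ray from [c] through [p] and beyond [p] are in [D], so [p]
   is in its closure. *)
exists c, p, d; split => // V nV.
have [d' d'0 Hd'] := (near_enorm p V).1 nV.
pose r := enorm (p - c).
pose t := Num.min d d' / (2 * r).
have m0 : 0 < Num.min d d' by rewrite lt_min d0.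
have t0 : 0 < t by rewrite divr_gt0// mulr_gt0.
have tn : enorm (p + t *: (p - c) - p) < Num.min d d'.
  rewrite addrC addKr enormZ gtr0_norm// /t -/r.
  have -> : Num.min d d' / (2 * r) * r = Num.min d d' / 2.
    by field; rewrite gt_eqF.
  lra.
exists (p + t *: (p - c)); split; last first.
  by apply: Hd'; rewrite (lt_le_trans tn)// ge_min lexx orbT.
apply: contact; first by rewrite (lt_le_trans tn)// ge_min lexx.
have -> : p + t *: (p - c) - c = (1 + t) *: (p - c).
  by rewrite scalerDl scale1r addrAC.
by rewrite enormZ gtr0_norm ?addr_gt0// ltr_pMl// ltrDl.
Unshelve. all: by end_near. Qed.

(** * Such a contact contradicts the gradient bound *)

(** The contact makes every ball around [x] of radius less than
    [enorm (x - c) - r] lie in [D], for [x] near [q].  So [ball_decay] yields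
    almost [v x <= expR (- mu * (enorm (x - c) - r))], whereas
    [decay_along_segment] shows that this is attained at [q].  The maximum of
    [v * expR (- mu w)], with [w] minus the strictly subharmonic function
    [enorm (x - c) - eta * enorm (x - q) ^+ 2], is therefore close to [q],
    and there [barrier_touching] contradicts the gradient bound. *)
Lemma no_contact_from_outside_disc {R : realType} (D : set 'rV[R]_2)
    (v : R -> 'rV[R]_2 -> R) (c p : 'rV[R]_2) (d mu0 : R) :
  open D -> bounded_set D ->
  (forall mu : R, 0 < mu -> dirichlet_solution D mu (v mu)) -> 0 < mu0 ->
  (forall mu : R, mu0 < mu ->
    forall x, D x -> enorm (grad (v mu) x) <= mu * v mu x) ->
  closure D p -> ~ D p -> 0 < enorm (p - c) -> 0 < d ->
  (forall y, enorm (y - p) < d -> enorm (p - c) < enorm (y - c) -> D y) ->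
  False.
Proof.
move=> oD bD sol mu00 gradv Dp nDp r0 d0 contact; set r := enorm (p - c) in r0 contact.
(* [q] is at distance [t] beyond [p]; [eta] keeps the corrected distance
   strictly subharmonic, [4 * eta < 1 / enorm (x - c)], on the disc of radius
   [rho] around [q].  On its circle the correction is [4 * kappa], of which
   [ball_decay], with these [alpha], [sigma] and a radius reduced by [kappa],
   loses at most [3 * kappa]. *)
pose t := d / 4; pose rho := t / 2; pose eta := (8 * (r + 2 * t))^-1.
pose kappa := eta * rho ^+ 2 / 4.
pose sigma := kappa / 2; pose alpha := 1 - kappa / (2 * t).
have t0 : 0 < t by rewrite /t; lra.
have rho0 : 0 < rho by rewrite /rho; lra.
have rt0 : 0 < 8 * (r + 2 * t) by lra.
have eta0 : 0 < eta by rewrite invr_gt0.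
have kappa0 : 0 < kappa by rewrite divr_gt0// mulr_gt0// exprn_gt0.
have kappat : kappa < t / 2.
  have et : eta * t < 1 by rewrite mulrC ltr_pdivrMr//; lra.
  have -> : kappa = (eta * t) * t / 16 by rewrite /kappa /rho; field.
  have : eta * t * t < 1 * t by rewrite ltr_pM2r.
  lra.
have sigma0 : 0 < sigma by rewrite /sigma; lra.
have kt : kappa / (2 * t) < 1 / 4 by rewrite ltr_pdivrMr; lra.
have kt0 : 0 < kappa / (2 * t) by rewrite divr_gt0//; lra.
have alpha0 : 0 < alpha by rewrite /alpha; lra.
have alpha1 : 0 < 1 - alpha ^+ 2.
  have -> : 1 - alpha ^+ 2 = (1 - alpha) * (1 + alpha) by ring.
  by rewrite mulr_gt0// /alpha; lra.
(* Beyond [mu0], and large enough for [ball_decay]. *)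
pose mu := mu0 + 1 + (2%:R * alpha / sigma) / (1 - alpha ^+ 2).
have hm : 0 < (2%:R * alpha / sigma) / (1 - alpha ^+ 2).
  by rewrite !divr_gt0 ?mulr_gt0.
have mu_gt0 : 0 < mu by rewrite /mu; lra.
have mu0mu : mu0 < mu by rewrite /mu; lra.
have hmu : 2%:R * alpha / sigma < mu * (1 - alpha ^+ 2).
  by rewrite -ltr_pdivrMr// /mu; lra.
have [C2 cv pde bc] := sol _ mu_gt0.
have v1 := max_principle oD bD mu_gt0 (sol _ mu_gt0).
have C1 : C1_on D (v mu) by case: C2.
have vp : v mu p = 1 by apply: bc; split=> // /interior_subset.
pose e := r^-1 *: (p - c).
have e1 : enorm e = 1.
  by rewrite enormZ gtr0_norm ?invr_gt0// mulVf// gt_eqF.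
have peE s : p + s *: e - c = (1 + s / r) *: (p - c).
  by rewrite /e scalerA addrAC scalerDl scale1r.
have normpe s : 0 <= s -> enorm (p + s *: e - c) = r + s.
  move=> s0; rewrite peE enormZ -/r ger0_norm ?addr_ge0 ?divr_ge0// ?ltW//.
  by field; rewrite gt_eqF.
have Dseg s : 0 < s -> s <= t -> D (p + s *: e).
  move=> s0 st; apply: contact; last by rewrite normpe; lra.
  rewrite addrC addKr enormZ e1 gtr0_norm// /t in st *; lra.
have vq := decay_along_segment oD C1 cv mu_gt0 (gradv _ mu0mu) Dp vp e1 t0 Dseg.
set q := p + t *: e in vq.
have qc : enorm (q - c) = r + t by apply/normpe/ltW.
have qp : enorm (q - p) = t by rewrite /q addrC addKr enormZ e1 gtr0_norm// mulr1.
have tri := @enormB_tri R 2; have sym := @enormBC R 2.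
have near_q (x : 'rV[R]_2) : enorm (x - q) <= rho ->
    r + t / 2 <= enorm (x - c) <= r + 3 / 2 * t.
  move=> xq; have := tri x q c; have := tri q x c; rewrite (sym q x) qc.
  by rewrite /rho in xq *; move=> ? ?; apply/andP; split; lra.
have ballD (x : 'rV[R]_2) s y : enorm (x - q) <= rho -> s < enorm (x - c) - r ->
    enorm (y - x) <= s -> D y.
  move=> xq sx yx; apply: contact.
    have := near_q _ xq; have := tri y x p; have := tri x q p; rewrite qp.
    by rewrite /rho /t in xq *; move=> ? ? /andP[? ?]; lra.
  by have := tri x y c; rewrite (sym x y); lra.
have qD x : enorm (x - q) <= rho -> D x.
  move=> xq; apply: (ballD x 0) => //; last by rewrite subrr enorm0.
  by have /andP[? _] := near_q _ xq; lra.
pose w := barrier (-1) eta 0 c q.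
have wE x : w x = - enorm (x - c) + eta * enorm (x - q) ^+ 2.
  by rewrite /w /barrier add0r mulN1r enorm_sqr.
pose F x := v mu x * expR (- (mu * w x)).
have cF : {in D, continuous F}.
  move=> y Dy; apply: (@continuousM _ _ (v mu) (fun y => expR (- (mu * w y)))).
    by case: C1 => cf _; exact: cf.
  apply: (@continuous_comp _ _ _ (fun y : 'rV[R]_2 => - (mu * w y)) expR).
    apply: continuousN; apply: continuousM; first exact: cst_continuous.
    exact: barrier_continuous.
  exact: continuous_expR.
have Fq : expR (mu * r) <= F q.
  have -> : mu * r = - (mu * t) + - (mu * w q).
    by rewrite wE subrr enorm0 expr0n mulr0 addr0 qc; ring.
  by rewrite expRD ler_pM2r ?expR_gt0.
have Fsphere x : enorm (x - q) = rho -> F x < F q.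
  move=> xq; apply: lt_le_trans Fq.
  have xq' : enorm (x - q) <= rho by rewrite xq.
  have /andP[xc1 xc2] := near_q _ xq'.
  pose s := enorm (x - c) - r - kappa.
  have s0 : 0 <= s by rewrite /s; lra.
  have H : v mu x <= expR (- (mu * (alpha * (s - sigma)))).
    apply: (@ball_decay _ 2 D (v mu) mu alpha sigma s x) => //.
    by move=> y; apply: (ballD x s y xq'); rewrite /s; lra.
  have as2 : s - 2 * kappa <= alpha * (s - sigma).
    rewrite /alpha mulrBl mul1r.
    have : kappa / (2 * t) * (s - sigma) <= kappa / (2 * t) * (2 * t).
      by rewrite ler_pM2l// /s; lra.
    rewrite divfK; last by rewrite gt_eqF//; lra.
    by rewrite /sigma; lra.
  apply: (@le_lt_trans _ _ (expR (- (mu * (s - 2 * kappa))) * expR (- (mu * w x)))).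
    rewrite ler_pM2r ?expR_gt0// (le_trans H)// ler_expR lerN2 ler_pM2l//.
  rewrite -expRD ltr_expR -opprD -mulrDr -mulrN ltr_pM2l// wE xq.
  have -> : eta * rho ^+ 2 = 4 * kappa by rewrite /kappa; field.
  by rewrite /s; lra.
(* At the maximum, [pE] and the gradient bound give [|g| <= 1], so
   [barrier_touching] needs a nonnegative laplacian of [w]. *)
have [x [xq Fx xmax]] := interior_max (ltW rho0) qD cF Fsphere.
have Dx : D x by apply/qD/ltW.
have vx : 0 < v mu x.
  have : 0 < F x by rewrite (lt_le_trans _ Fx)// (lt_le_trans _ Fq)// expR_gt0.
  by rewrite pmulr_lgt0 ?expR_gt0.
have /andP[xc1 xc2] := near_q _ (ltW xq).
have xc0 : 0 < enorm (x - c) by lra.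
have h0 : 0 < 0 + sqnorm (x - c) by rewrite add0r -enorm_sqr exprn_gt0.
have [] := barrier_touching oD Dx C2 h0 (pde _ Dx) vx xmax.
rewrite add0r -/(enorm (x - c)) -enorm_sqr => pE0.
pose g (i : 'I_2) := -1 * (x 0 i - c 0 i) / enorm (x - c) +
  2 * eta * (x 0 i - q 0 i).
have pE i : partial i (v mu) x = mu * g i * v mu x := pE0 i.
have gle1 : \sum_i g i ^+ 2 <= 1.
  have mv0 : 0 <= mu * v mu x by rewrite mulr_ge0// ltW.
  have := gradv _ mu0mu _ Dx.
  rewrite -(@ler_pXn2r _ 2)// ?nnegrE ?enorm_ge0// enorm_sqr /sqnorm.
  under eq_bigr do rewrite !mxE pE -/(g _) mulrAC exprMn.
  by rewrite -mulr_sumr ger_pMr// exprn_gt0// mulr_gt0.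
have -> : -1 * (2%:R / enorm (x - c) - enorm (x - c) ^+ 2 / enorm (x - c) ^+ 3) +
     2 * 2%:R * eta = 4 * eta - (enorm (x - c))^-1.
  by field; rewrite gt_eqF.
have lap : 4 * eta - (enorm (x - c))^-1 < 0.
  rewrite subr_lt0 /eta invfM mulrA -[4 / 8]/(4 * 8^-1).
  have rt : 0 < r + 2 * t by clear -r0 t0; lra.
  apply: (@lt_le_trans _ _ (r + 2 * t)^-1).
    by rewrite gtr_pMl ?invr_gt0//; clear; lra.
  by rewrite lef_pV2 ?posrE//; clear -xc2 t0; lra.
have : mu * (4 * eta - (enorm (x - c))^-1) < 0 by rewrite pmulr_rlt0.
have : mu ^+ 2 * (\sum_i g i ^+ 2) <= mu ^+ 2 by rewrite ger_pMr// exprn_gt0.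
move=> H1 H2 H3; have := le_lt_trans H3 (ltr_leD H2 H1).
by rewrite add0r ltxx.
Qed.

Unset Implicit Arguments.

Theorem theorem1p1 (R : realType) (D : set 'rV[R]_2)
    (v : R -> 'rV[R]_2 -> R) :
  domain D -> bounded_set D -> C2_boundary D ->
  (forall mu : R, 0 < mu -> dirichlet_solution D mu (v mu)) ->
  (exists2 mu0 : R, 0 < mu0 &
    forall mu : R, mu0 < mu ->
      forall x, D x -> enorm (grad (v mu) x) <= mu * v mu x) ->
  convex_set D.
Proof.
move=> [_ oD cD] bD _ sol [mu0 mu00 gradv]; apply: contrapT => nD.
have [c [p [d [Dp nDp pc0 d0 contact]]]] := contact_from_outside_disc oD cD nD.
exact: (no_contact_from_outside_disc oD bD sol mu00 gradv Dp nDp pc0 d0 contact).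
Qed.
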